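(* Let $H<G$ be finite groups with $\operatorname{core}_G(H)=1$, and suppose the interval $[H,G]=\{K\mid H\le K\le G\}$ in the subgroup lattice of $G$ is isomorphic to the lattice $L_7$. Then the following hold. (i) $G$ is a primitive permutation group. (ii) If $N$ is a nontrivial normal subgroup of $G$, then $C_G(N)=1$. (iii) $G$ contains no nontrivial abelian normal subgroup. (iv) $G$ is not solvable. (v) $G$ is subdirectly irreducible. (vi) With the possible exception of at most one maximal subgroup of $G$, all proper subgroups $X$ of $G$ in the interval $[H,G]$ (i.e. $H\le X<G$) are core-free in $G$.
   Context: $L_7$ is the seven-element lattice with elements $0,1,j_1,j_2,m_1,m_2,k$ whose covering relations are exactly $0\prec j_1$, $0\prec j_2$, $0\prec k$, $j_1\prec m_2$, $j_2\prec m_1$, $j_2\prec m_2$, $m_1\prec 1$, $m_2\prec 1$, $k\prec 1$. For $X\le G$, $\operatorname{core}_G(X)=\bigcap_{g\in G}gXg^{-1}$ is the largest normal subgroup of $G$ contained in $X$; $X$ is core-free in $G$ if $\operatorname{core}_G(X)=1$. A finite group is called primitive (a primitive permutation group) if it has a core-free maximal subgroup. A group is subdirectly irreducible if it has a unique minimal normal subgroup (minimal normal subgroups are nontrivial by definition). $C_G(N)$ is the centralizer of $N$ in $G$. *)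

(* Defs.v *)
From HB Require Import structures.
From mathcomp Require Import all_boot all_order all_fingroup all_solvable.

Set Implicit Arguments.
Unset Strict Implicit.
Unset Printing Implicit Defensive.

Import Order.TTheory.
Local Open Scope group_scope.

Inductive L7 : Type := L7_0 | L7_1 | L7_j1 | L7_j2 | L7_m1 | L7_m2 | L7_k.

Definition L7_enum : seq L7 := [:: L7_0; L7_1; L7_j1; L7_j2; L7_m1; L7_m2; L7_k].

Definition L7_code (x : L7) : nat :=
  match x with
  | L7_0 => 0 | L7_1 => 1 | L7_j1 => 2 | L7_j2 => 3
  | L7_m1 => 4 | L7_m2 => 5 | L7_k => 6
  end%N.

Definition L7_decode (n : nat) : L7 := nth L7_0 L7_enum n.

Lemma L7_codeK : cancel L7_code L7_decode. Proof. by case. Qed.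

HB.instance Definition _ := Countable.copy L7 (can_type L7_codeK).

Lemma L7_enumP : Finite.axiom L7_enum. Proof. by case. Qed.

HB.instance Definition _ := isFinite.Build L7 L7_enumP.

Definition L7_cover (x y : L7) : bool :=
  match x, y with
  | L7_0, L7_j1 | L7_0, L7_j2 | L7_0, L7_k
  | L7_j1, L7_m2 | L7_j2, L7_m1 | L7_j2, L7_m2
  | L7_m1, L7_1 | L7_m2, L7_1 | L7_k, L7_1 => true
  | _, _ => false
  end.

(* [connect] is the reflexive transitive closure. *)
Definition L7_le : rel L7 := connect L7_cover.

Definition L7_leb (x y : L7) : bool :=
  match x, y with
  | L7_0, _ | _, L7_1 => true
  | L7_j1, (L7_j1 | L7_m2) | L7_j2, (L7_j2 | L7_m1 | L7_m2)
  | L7_m1, L7_m1 | L7_m2, L7_m2 | L7_k, L7_k => true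
  | _, _ => false
  end.

Lemma L7_leE : L7_le =2 L7_leb.
Proof.
have c2 a b c : L7_cover a b -> L7_cover b c -> L7_le a c.
  by move=> ab bc; apply: connect_trans (connect1 ab) (connect1 bc).
move=> x y; apply/idP/idP.
  case/connectP=> p; elim: p x => [|z p IHp] x /= => [_ -> | /andP[xz zp] ly].
    by case: x.
  by move: (IHp z zp ly) xz; case: {IHp zp ly} x; case: z; case: y.
case: x; case: y => // _; try exact: connect0; try exact: connect1;
  first [ exact: (@c2 _ L7_m1) | exact: (@c2 _ L7_m2) | exact: (@c2 _ L7_j1)
        | exact: (@c2 _ L7_j2)
        | exact: connect_trans (@connect1 _ _ L7_0 L7_k isT) (connect1 _) ].
Qed.

Lemma L7_le_refl : reflexive L7_le.
Proof. exact: connect0. Qed.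

Lemma L7_le_anti : antisymmetric L7_le.
Proof. by move=> x y; rewrite !L7_leE; case: x; case: y. Qed.

Lemma L7_le_trans : transitive L7_le.
Proof. exact: connect_trans. Qed.

Fact L7_display : Order.disp_t. Proof. exact: Order.Disp tt tt. Qed.

HB.instance Definition _ :=
  Order.Le_isPOrder.Build L7_display L7 L7_le_refl L7_le_anti L7_le_trans.

Lemma L7_coverP (x y : L7) :
  reflect ((x < y)%O /\ (forall z : L7, ~~ (x < z < y)%O)) (L7_cover x y).
Proof.
have ltE a b : (a < b :> L7)%O = (b != a) && L7_leb a b.
  by rewrite lt_def -L7_leE.
apply: (iffP idP) => [|[]].
  by move=> xy; rewrite ltE; split=> [|z]; rewrite ?ltE; move: xy;
     case: x; case: y => //; case: z.
rewrite ltE => xy nxy.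
have := nxy L7_j1; have := nxy L7_j2; have := nxy L7_m2; have := nxy L7_k.
by rewrite !ltE; move: xy {nxy}; case: x; case: y.
Qed.

Definition L7_meet (x y : L7) : L7 :=
  if L7_leb x y then x else if L7_leb y x then y else
  match x, y with
  | L7_m1, L7_m2 | L7_m2, L7_m1 => L7_j2
  | _, _ => L7_0
  end.

Definition L7_join (x y : L7) : L7 :=
  if L7_leb x y then y else if L7_leb y x then x else
  match x, y with
  | L7_j1, L7_j2 | L7_j2, L7_j1 => L7_m2
  | _, _ => L7_1
  end.

Lemma L7_lexI (x y z : L7) :
  (x <= L7_meet y z)%O = (x <= y)%O && (x <= z)%O.
Proof. by rewrite /Order.le /= !L7_leE; case: x; case: y; case: z. Qed.

Lemma L7_leUx (x y z : L7) :
  (L7_join x y <= z)%O = (x <= z)%O && (y <= z)%O.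
Proof. by rewrite /Order.le /= !L7_leE; case: x; case: y; case: z. Qed.

HB.instance Definition _ :=
  Order.POrder_MeetJoin_isLattice.Build L7_display L7 L7_lexI L7_leUx.

Section Groups.

Variable gT : finGroupType.
Implicit Types G H X N M : {group gT}.

Definition group_interval H G : {set {group gT}} :=
  [set K : {group gT} | (H \subset K) && (K \subset G)].

(* The lattice operations of [group_interval H G] are those induced by its
   inclusion order, so a lattice isomorphism is an order isomorphism. *)
Definition interval_isom H G d (L : finLatticeType d) : Prop :=
  exists f : L -> {group gT},
    [/\ injective f,
        f @: [set: L] = group_interval H G
      & {mono f : x y / (x <= y)%O >-> x \subset y}].

Definition core_free X G : bool := gcore X G == 1.

Definition primitive_group G : Prop :=
  exists2 M : {group gT}, maximal M G & core_free M G.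

(* [minnormal N G] only asks that G normalise N, hence [N \subset G]. *)
Definition subdirectly_irreducible G : Prop :=
  exists! N : {group gT}, N \subset G /\ minnormal N G.

End Groups.

(* Main.v *)
Require Import Defs.
From HB Require Import structures.
From mathcomp Require Import all_boot all_order all_fingroup all_solvable.

Local Open Scope group_scope.

(** For N normal in G, the group NH lies in [H,G], and by Dedekind's law it is
    a modular element of that lattice.  The only modular elements of L7 are 0,
    m1, m2 and 1, and NH = H forces N = 1 because H is core-free.  If two
    nontrivial normal subgroups N and C centralise each other and CX = G with X
    in [H,G], then N :&: X is normalised by both C and X, hence normal in G, so
    that NH :&: X = (N :&: X)H is again one of 0, m1, m2, 1; a suitable X
    contradicts this for each possible pair (NH, CH).  So no two nontrivial
    normal subgroups of G commute, and all the claims follow. *)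

(** * Normal subgroups seen inside an interval isomorphic to an arbitrary finite lattice *)

Section IntervalIsomorphism.

Set Implicit Arguments.
Unset Strict Implicit.

Import Order.LTheory.

Variables (gT : finGroupType) (H G : {group gT}).
Variables (d : Order.disp_t) (L : finLatticeType d) (f : L -> {group gT}).
Hypothesis f_inj : injective f.
Hypothesis f_im : f @: [set: L] = group_interval H G.
Hypothesis f_mono : {mono f : x y / (x <= y)%O >-> x \subset y}.

Lemma isom_sub x : H \subset f x /\ f x \subset G.
Proof.
have: f x \in group_interval H G by rewrite -f_im imset_f.
by rewrite inE => /andP[].
Qed.

Lemma isom_surj (X : {group gT}) :
  H \subset X -> X \subset G -> exists x, f x = X.
Proof.
move=> sHX sXG; have: X \in f @: [set: L] by rewrite f_im inE sHX.
by case/imsetP=> x _ ->; exists x.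
Qed.

Lemma isom_meet x y : f (Order.meet x y) :=: f x :&: f y.
Proof.
have [[Hx xG] [Hy _]] := (isom_sub x, isom_sub y).
have [||z def_z] := isom_surj (X := (f x :&: f y)%G).
- by rewrite subsetI Hx.
- by rewrite subIset ?xG.
apply/eqP; rewrite eqEsubset subsetI !f_mono leIl leIr /=.
(* Seen as a group, the intersection is some [f z], so the inclusion becomes [z <= x] and [z <= y]
   in [L]. *)
by rewrite -[f x :&: f y]/(gval (f x :&: f y)%G) -def_z f_mono lexI -!f_mono
           def_z subsetIl subsetIr.
Qed.

Lemma isom_join x y : f (Order.join x y) :=: f x <*> f y.
Proof.
have [[Hx xG] [_ yG]] := (isom_sub x, isom_sub y).
have [||z def_z] := isom_surj (X := (f x <*> f y)%G).
- exact: subset_trans Hx (joing_subl _ _).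
- by rewrite join_subG xG.
apply/eqP; rewrite eqEsubset join_subG !f_mono leUl leUr andbT.
by rewrite -[f x <*> f y]/(gval (f x <*> f y)%G) -def_z f_mono leUx -!f_mono
           def_z joing_subl joing_subr.
Qed.

(** A relation rather than a function: surjectivity of [f] only provides such an [n]
    existentially. *)
Definition normal_image (N : {group gT}) n := N <| G /\ f n :=: N * H.

Lemma normal_image_exists (N : {group gT}) :
  H \subset G -> N <| G -> exists n, normal_image N n.
Proof.
move=> sHG nsNG; have [sNG nNG] := andP nsNG.
have [||n def_n] := isom_surj (X := (N <*> H)%G); first exact: joing_subr.
  by rewrite join_subG sNG.
by exists n; split=> //; rewrite def_n /= norm_joinEr ?(subset_trans sHG).
Qed.

Lemma normal_image_join N n x :
  normal_image N n -> f (Order.join n x) :=: N * f x.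
Proof.
case=> nsNG def_n; have [Hx xG] := isom_sub x.
have nN := subset_trans _ (normal_norm nsNG).
rewrite isom_join def_n -norm_joinEr ?nN ?(subset_trans Hx) //.
by rewrite -joingA (joing_idPr Hx) norm_joinEr ?nN.
Qed.

(** Dedekind's law, applicable because [H] lies in [f y]. *)
Lemma normal_image_meet N n y :
  normal_image N n -> f (Order.meet n y) :=: (N :&: f y) * H.
Proof.
case=> nsNG def_n; have [Hy _] := isom_sub y.
by rewrite isom_meet def_n setIC -group_modr // setIC.
Qed.

Lemma normal_image_le (N : {group gT}) n x :
  normal_image N n -> N \subset f x -> (n <= x)%O.
Proof.
by case=> _ def_n sNx; rewrite -f_mono def_n mul_subG //; case: (isom_sub x).
Qed.

(** Both sides map to [(N :&: f y) * f x], by Dedekind's law for [f x \subset f y]. *)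
Lemma normal_image_modularl N n x y : normal_image N n -> (x <= y)%O ->
  Order.join x (Order.meet n y) = Order.meet (Order.join n x) y.
Proof.
move=> nN lexy; apply/f_inj/val_inj => /=.
have [Hx xG] := isom_sub x; have sxy: f x \subset f y by rewrite f_mono.
have nNx : f x \subset 'N(N) := subset_trans xG (normal_norm nN.1).
rewrite [RHS]isom_meet (normal_image_join _ nN) setIC -group_modr // setIC.
rewrite [LHS]isom_join (normal_image_meet _ nN) -norm_joinEr; last first.
  by rewrite normsI ?(subset_trans Hx) // (subset_trans sxy) ?normG.
rewrite joingC -joingA (joing_idPr Hx) norm_joinEr //.
by rewrite normsI // (subset_trans sxy) ?normG.
Qed.

(** Both sides map to [N * (f y :&: f x)], by Dedekind's law for [N \subset f y]. *)
Lemma normal_image_modularr N n x y : normal_image N n -> (n <= y)%O ->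
  Order.join n (Order.meet y x) = Order.meet y (Order.join n x).
Proof.
move=> nN leny; apply/f_inj/val_inj => /=.
have sNy : N \subset f y.
  by apply: subset_trans (_ : f n \subset _); rewrite ?f_mono // nN.2 mulG_subl.
rewrite [LHS](normal_image_join _ nN) !isom_meet (normal_image_join _ nN).
by rewrite setIC group_modl // setIC.
Qed.

(** Conjugation by [C] fixes [N :&: f x] pointwise, and [f x] normalises both [N] and itself, so
    [G = C * f x] normalises the intersection. *)
Lemma normal_image_centralised (N C : {group gT}) n c x :
    normal_image N n -> normal_image C c -> C \subset 'C(N) ->
    f (Order.join c x) :=: G ->
  normal_image (N :&: f x)%G (Order.meet n x).
Proof.
move=> nN nC cNC; rewrite (normal_image_join _ nC) => defG.
split; last by rewrite (normal_image_meet _ nN).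
have [sNG nNG] := andP nN.1; have [_ xG] := isom_sub x.
rewrite /normal subIset ?sNG //= -{1}defG mul_subG //.
  by rewrite cents_norm // (subset_trans cNC) ?centS ?subsetIl.
by rewrite normsI ?normG ?(subset_trans xG).
Qed.

End IntervalIsomorphism.

(** * Which elements of [L7] come from normal subgroups, and which subgroups are core-free *)

Section IntervalL7.

Set Implicit Arguments.
Unset Strict Implicit.

Variables (gT : finGroupType) (H G : {group gT}) (f : L7 -> {group gT}).
Hypotheses (ltHG : H \proper G) (coreH : core_free H G).
Hypothesis f_inj : injective f.
Hypothesis f_im : f @: [set: L7] = group_interval H G.
Hypothesis f_mono : {mono f : x y / (x <= y)%O >-> x \subset y}.

Local Notation image := (normal_image H G f).

Lemma L7_le_leb (x y : L7) : (x <= y)%O = L7_leb x y.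
Proof. by rewrite -L7_leE. Qed.

Lemma isomL7_0 : f L7_0 = H.
Proof.
have [x def_x] := isom_surj f_im (subxx H) (proper_sub ltHG).
apply/val_inj/eqP; rewrite eqEsubset andbC (isom_sub f_im _).1 /=.
by rewrite -def_x f_mono L7_le_leb.
Qed.

Lemma isomL7_1 : f L7_1 = G.
Proof.
have [x def_x] := isom_surj f_im (proper_sub ltHG) (subxx G).
apply/val_inj/eqP; rewrite eqEsubset (isom_sub f_im _).2 /=.
by rewrite -def_x f_mono L7_le_leb; case: (x).
Qed.

(** The pentagons with long side [j1 < m2] or [j2 < m1] and short side [k] exclude [j1] and [j2] as
    the lower elements of a long side; [k] is excluded as a short side. *)
Lemma normal_imageL7 N n : image N n -> n \in [:: L7_0; L7_m1; L7_m2; L7_1].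
Proof.
move=> nN; case: n nN => // nN.
- have := normal_image_modularr f_inj f_im f_mono L7_k (y := L7_m2) nN.
  by rewrite L7_le_leb => /(_ isT).
- have := normal_image_modularr f_inj f_im f_mono L7_k (y := L7_m1) nN.
  by rewrite L7_le_leb => /(_ isT).
have := normal_image_modularl f_inj f_im f_mono (x := L7_j1) (y := L7_m2) nN.
by rewrite L7_le_leb => /(_ isT).
Qed.

Lemma normal_imageL7_nontrivial (N : {group gT}) n :
  image N n -> N :!=: 1 -> n \in [:: L7_m1; L7_m2; L7_1].
Proof.
move=> nN ntN; have := normal_imageL7 nN.
rewrite inE => /predU1P[n0 | //]; case/negP: ntN.
have sNH : N \subset H by rewrite -isomL7_0 -n0 nN.2 mulG_subl.
rewrite -subG1 -(eqP coreH); apply: gcore_max sNH _.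
exact: normal_norm nN.1.
Qed.

Lemma centralised_normal_trivial (N C : {group gT}) :
  N <| G -> C <| G -> C \subset 'C(N) -> N :!=: 1 -> C :==: 1.
Proof.
move=> nsNG nsCG cNC ntN; apply/idPn=> ntC.
have cCN : N \subset 'C(C) by rewrite centsC.
have [n nN] := normal_image_exists f_im (proper_sub ltHG) nsNG.
have [c nC] := normal_image_exists f_im (proper_sub ltHG) nsCG.
have meetP (A B : {group gT}) a b x : image A a -> image B b ->
    B \subset 'C(A) -> Order.join b x = L7_1 ->
  Order.meet a x \in [:: L7_0; L7_m1; L7_m2; L7_1].
- move=> nA nB cAB bx1; apply: normal_imageL7.
  apply: (normal_image_centralised f_im f_mono nA nB cAB).
  by rewrite bx1 isomL7_1.
have NC x := meetP N C n c x nN nC cNC.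
have CN x := meetP C N c n x nC nN cCN.
have := normal_imageL7_nontrivial nC ntC.
have := normal_imageL7_nontrivial nN ntN.
(* In each of the nine cases the chosen [x] joins one of [n], [c] to the top, while its meet with
   the other is [k], [j1] or [j2]. Take [k] if [n] or [c] is the top, [j1] if they are [m1] and [m2]
   in some order, and the other of [m1], [m2] if they coincide. *)
case: (n) NC CN => // NC CN _; case: (c) NC CN => // NC CN _.
- by have := NC L7_k erefl.
- by have := NC L7_k erefl.
- by have := NC L7_k erefl.
- by have := CN L7_k erefl.
- by have := NC L7_m2 erefl.
- by have := CN L7_j1 erefl.
- by have := CN L7_k erefl.
- by have := NC L7_j1 erefl.
- by have := NC L7_m1 erefl.
Qed.

(** A nontrivial core would give an element of [m1], [m2], [1] below [x], and these three form an
    up-set. *)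
Lemma core_free_outside_m12 x :
  x \notin [:: L7_m1; L7_m2; L7_1] -> core_free (f x) G.
Proof.
apply: contraR => ntC; have [_ xG] := isom_sub f_im x.
have nsC : gcore_group (f x) G <| G.
  by rewrite /normal gcore_norm (subset_trans (gcore_sub _ _)).
have [c nC] := normal_image_exists f_im (proper_sub ltHG) nsC.
have := normal_image_le f_im f_mono nC (gcore_sub _ _).
have := normal_imageL7_nontrivial nC ntC.
by rewrite L7_le_leb; case: (c); case: (x).
Qed.

(** The commutator of the two cores is normalised by [G] and lies in
    [f L7_m1 :&: f L7_m2 = f L7_j2], which is core-free. Hence the cores commute and one of them is
    trivial. *)
Lemma core_free_m12 : core_free (f L7_m1) G || core_free (f L7_m2) G.
Proof.
apply: contraTT isT; rewrite negb_or => /andP[nt1 nt2].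
have nsC x : gcore_group (f x) G <| G.
  have [_ xG] := isom_sub f_im x.
  by rewrite /normal gcore_norm (subset_trans (gcore_sub _ _)).
case/negP: nt2; apply: (centralised_normal_trivial (nsC L7_m1)) nt1 => //.
rewrite centsC; apply/commG1P/eqP; rewrite -subG1.
have /eqP <- : core_free (f L7_j2) G by exact: core_free_outside_m12.
apply: gcore_max; last by rewrite normsR ?gcore_norm.
rewrite (_ : L7_j2 = Order.meet L7_m1 L7_m2) // (isom_meet f_im f_mono).
apply: subset_trans (setISS (gcore_sub _ G) (gcore_sub _ G)).
by rewrite subsetI commg_subl commg_subr
           !(subset_trans (normal_sub (nsC _))) ?gcore_norm.
Qed.

Lemma isomL7_maximal x : x \in [:: L7_m1; L7_m2; L7_k] -> maximal (f x) G.
Proof.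
have lt_sub y z : (f y \proper f z) = L7_leb y z && ~~ L7_leb z y.
  by rewrite properE !f_mono !L7_le_leb.
move=> xmax; apply/maxgroupP; split=> [|K ltKG sxK].
  by rewrite -isomL7_1 lt_sub; case: (x) xmax.
have [Hx _] := isom_sub f_im x.
have [y def_y] := isom_surj f_im (subset_trans Hx sxK) (proper_sub ltKG).
move: ltKG sxK; rewrite -def_y -{1}isomL7_1 lt_sub f_mono L7_le_leb => y1 xy.
by congr (gval (f _)); case: (x) (y) xmax xy y1 => [] [].
Qed.

End IntervalL7.

Theorem theorem6p3p1 (gT : finGroupType) (H G : {group gT})
    (ltHG : H \proper G) (coreH : core_free H G)
    (isoL7 : interval_isom H G L7) :
  (* (i) *) primitive_group G /\
  (* (ii) *)
  (forall N : {group gT}, N <| G -> N :!=: 1 -> 'C_G(N) = 1) /\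
  (* (iii) *)
  (~ exists N : {group gT}, [/\ N <| G, N :!=: 1 & abelian N]) /\
  (* (iv) *) ~~ solvable G /\
  (* (v) *) subdirectly_irreducible G /\
  (* (vi) *)
  (exists E : {set {group gT}},
     [/\ (#|E| <= 1)%N,
         (forall M : {group gT}, M \in E -> maximal M G)
       & forall X : {group gT},
           X \in group_interval H G -> X \proper G -> X \notin E ->
           core_free X G]).
Proof.
have [f [f_inj f_im f_mono]] := isoL7.
have noncomm N C :=
  @centralised_normal_trivial _ _ _ _ ltHG coreH f_inj f_im f_mono N C.
(* An abelian [N] centralises itself, so [noncomm] applies with [C := N]. *)
have noabelian (N : {group gT}) : N <| G -> abelian N -> N :==: 1.
  by move=> nsNG abN; apply/idPn=> ntN; case/negP: (ntN); apply: (noncomm N).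
have ntG : G :!=: 1.
  by apply: contraTneq ltHG => ->; rewrite properE sub1G andbF.
split; last split; last split; last split; last split.
- exists (f L7_k); first exact: (isomL7_maximal ltHG f_im f_mono).
  exact: (core_free_outside_m12 ltHG coreH f_inj f_im f_mono).
- move=> N nsNG ntN; apply/eqP; apply: (noncomm N 'C_G(N)%G) => //=.
    by rewrite /normal subsetIl normsI ?normG ?norms_cent ?normal_norm.
  exact: subsetIr.
- by case=> N [nsNG ntN abN]; case/negP: ntN; apply: noabelian.
- apply/negP=> solG; have [M minM sMG] := minnormal_exists ntG (normG G).
  have [_ ntM abM] := minnormal_solvable minM sMG solG.
  case/negP: ntM; apply: noabelian (abelem_abelian abM).
  by have [/andP[_ nMG] _] := mingroupP minM; rewrite /normal sMG.
- have [M minM sMG] := minnormal_exists ntG (normG G).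
  exists M; split=> // N [sNG minN]; apply/val_inj/eqP/idPn=> neqMN.
  have [/andP[ntM nMG] _] := mingroupP minM.
  have [/andP[ntN nNG] _] := mingroupP minN.
  (* If [[~: M, N]] were nontrivial, minimality would make it equal to both [M] and [N]. *)
  have cMN : N \subset 'C(M).
    rewrite centsC; apply/commG1P/eqP/idPn=> ntR.
    have nR : G \subset 'N([~: M, N]) by rewrite normsR.
    have minR (A : {group gT}) : minnormal A G -> [~: M, N] \subset A ->
        [~: M, N] = A.
      case/mingroupP=> _ minA sRA.
      exact: (minA [~: M, N]%G (introT andP (conj ntR nR)) sRA).
    have sRM : [~: M, N] \subset M by rewrite commg_subl (subset_trans sNG).
    have sRN : [~: M, N] \subset N by rewrite commg_subr (subset_trans sMG).
    by case/eqP: neqMN; rewrite /= -(minR M) // (minR N).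
  by case/negP: ntN; apply: (noncomm M); rewrite ?/normal ?sMG ?sNG.
pose E := [set X in [:: f L7_m1; f L7_m2] | ~~ core_free X G].
exists E; split=> [|M|X].
(* [M] is the only possible member of [E], since [f L7_m1] and [f L7_m2] cannot both have nontrivial
   core. *)
- pose M := if core_free (f L7_m1) G then f L7_m2 else f L7_m1.
  rewrite -(cards1 M) {}/M; apply/subset_leq_card/subsetP=> X; rewrite !inE => /andP[].
  case/pred2P=> -> ntX; first by rewrite (negbTE ntX).
  have := core_free_m12 ltHG coreH f_inj f_im f_mono.
  by rewrite (negbTE ntX) orbF => ->.
- rewrite !inE => /andP[/pred2P[] -> _];
    exact: (isomL7_maximal ltHG f_im f_mono).
rewrite -f_im => /imsetP[x _ ->] ltXG; apply: contraR => ntX.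
rewrite !inE ntX andbT; apply: contraR ntX; rewrite !(inj_eq f_inj) => nx.
apply: (core_free_outside_m12 ltHG coreH f_inj f_im f_mono).
(* Only [x = L7_1] remains to be excluded, and it would give [f x = G], which is not proper. *)
rewrite !inE orbA negb_or nx /=; apply: contraTneq ltXG => ->.
by rewrite (isomL7_1 ltHG f_im f_mono) properxx.
Qed.
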